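(* Let $\phi$ be a Boolean formula over $n$ propositional variables and let $\varepsilon,\delta\in(0,1)$. Any (possibly randomized and adaptive) algorithm that, for every such input formula $\phi$, outputs an $(\varepsilon,\delta)$-approximation of $|\mathrm{sol}(\phi)|$ using only queries to a SAT oracle in the query model described below must make $\tilde{\Omega}(\log n)$ queries to the SAT oracle. Here the tilde hides a factor of $\log\log n$, i.e. the bound is $\Omega(\log n/\log\log n)$.
   Context: For a Boolean formula $\phi$ over variables $v_1,\dots,v_n$, $\mathrm{sol}(\phi)\subseteq\{T,F\}^n$ denotes its set of satisfying assignments. An estimate $\mathsf{Est}$ is an $(\varepsilon,\delta)$-approximation of $|\mathrm{sol}(\phi)|$ if $\Pr\left[\frac{|\mathrm{sol}(\phi)|}{1+\varepsilon}\le \mathsf{Est}\le (1+\varepsilon)|\mathrm{sol}(\phi)|\right]\ge 1-\delta$. A SAT oracle takes a Boolean formula as input and returns a satisfying assignment if the formula is satisfiable, and $\bot$ otherwise. Query model (Stockmeyer's): for any set $A\subseteq\{T,F\}^n$ let $\psi_A$ be a formula with $\mathrm{sol}(\psi_A)=A$; the algorithm accesses the input $\phi$ only by querying the oracle on formulas of the form $\phi_A:=\phi\wedge\psi_A$ for arbitrary (adaptively chosen) sets $A$. *)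

(* Defs.v *)
From HB Require Import structures.
From mathcomp Require Import all_boot all_order all_algebra.
From mathcomp Require Import all_classical all_reals all_analysis.

Set Implicit Arguments.
Unset Strict Implicit.
Unset Printing Implicit Defensive.

Import Order.TTheory GRing.Theory Num.Theory.
Local Open Scope ring_scope.

Definition assignment (n : nat) := {ffun 'I_n -> bool}.

Inductive formula (n : nat) : Type :=
| FTrue
| FVar of 'I_n
| FNot of formula n
| FAnd of formula n & formula n
| FOr of formula n & formula n.
Arguments FTrue {n}.

Fixpoint feval (n : nat) (s : assignment n) (phi : formula n) : bool :=
  match phi with
  | FTrue => true
  | FVar i => s i
  | FNot f => ~~ feval s f
  | FAnd f g => feval s f && feval s g
  | FOr f g => feval s f || feval s g
  end.

Definition sol (n : nat) (phi : formula n) : {set assignment n} :=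
  [set s : assignment n | feval s phi]%SET.

(* [None] is the answer "unsatisfiable". *)
Definition sat_oracle (n : nat) (O : formula n -> option (assignment n)) : Prop :=
  forall f : formula n,
    match O f with
    | Some s => is_true (s \in sol f)
    | None => sol f = finset.set0
    end.

Definition defines_sets (n : nat) (psi : {set assignment n} -> formula n) : Prop :=
  forall A : {set assignment n}, sol (psi A) = A.

Lemma defines_sets_ex (n : nat) :
  exists psi : {set assignment n} -> formula n, defines_sets psi.
Proof.
pose lit (a : assignment n) i := if a i then FVar i else FNot (FVar i).
pose cube a := foldr (fun i f => FAnd (lit a i) f) FTrue (enum 'I_n).
pose dnf (A : {set assignment n}) :=
  foldr (fun a f => FOr (cube a) f) (FNot FTrue) (enum A).
have cubeE a s : feval s (cube a) = (s == a).
  have -> : feval s (cube a) = all (fun i => s i == a i) (enum 'I_n).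
    rewrite /cube; elim: (enum 'I_n) => //= i r ->.
    by congr (_ && _); rewrite /lit; case: (a i) => /=; case: (s i).
  apply/allP/eqP => [sa|-> //].
  by apply/ffunP => i; apply/eqP/sa; rewrite mem_enum.
exists dnf => A; apply/finset.setP => s; rewrite inE -(mem_enum A) /dnf.
by elim: (enum A) => //= a r ->; rewrite cubeE inE.
Qed.

(* A deterministic adaptive algorithm. [Query A k] asks the oracle about
   phi /\ psi_A and continues with [k] applied to the answer; the input formula
   itself does not occur in the tree. *)
Inductive algorithm (n : nat) (E : Type) : Type :=
| Output of E
| Query of {set assignment n} & (option (assignment n) -> algorithm n E).

Section Run.
Variables (n : nat) (E : Type).
Variables (psi : {set assignment n} -> formula n).
Variables (O : formula n -> option (assignment n)) (phi : formula n).

Fixpoint estimate (a : algorithm n E) : E :=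
  match a with
  | Output e => e
  | Query A k => estimate (k (O (FAnd phi (psi A))))
  end.

Fixpoint num_queries (a : algorithm n E) : nat :=
  match a with
  | Output _ => 0%N
  | Query A k => (num_queries (k (O (FAnd phi (psi A))))).+1
  end.

End Run.

Section Approximation.
Context {R : realType} {d : measure_display} {T : measurableType d}.
Variable P : probability T R.

Definition approximates (eps delta : R) (n : nat) (phi : formula n)
    (Est : T -> R) : Prop :=
  let s : R := #|sol phi|%:R in
  ((1 - delta)%:E <=
     P [set w | (s / (1 + eps) <= Est w <= (1 + eps) * s)%R]%classic)%E.

(* A randomized algorithm is a random deterministic one: all internal coins are
   collected in the sample point [w : T]. *)
Definition randomized_counter (eps delta : R) (n : nat)
    (psi : {set assignment n} -> formula n) (alg : T -> algorithm n R) : Prop :=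
  forall (phi : formula n) (O : formula n -> option (assignment n)),
    sat_oracle O ->
    measurable_fun setT (fun w => estimate psi O phi (alg w)) /\
    approximates eps delta phi (fun w => estimate psi O phi (alg w)).

Definition makes_at_most (q : nat) (n : nat)
    (psi : {set assignment n} -> formula n) (alg : T -> algorithm n R) : Prop :=
  forall (phi : formula n) (O : formula n -> option (assignment n)),
    sat_oracle O ->
    {ae P, forall w, (num_queries psi O phi (alg w) <= q)%N}.

End Approximation.

(* Main.v *)
(* Order the assignments, let the oracle answer with the first satisfying
   assignment, and take as inputs the formulas phi_j whose solutions are the
   first 4^j assignments, 0 <= j <= n/2.  On phi_j /\ psi_A the answer is either
   "unsatisfiable" or the first element of A, which does not depend on j.  So,
   for fixed coins, the runs on all the phi_j follow a binary tree with at most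
   2^q leaves.  As (1 + eps)^2 < 4, the output at a leaf is a valid estimate for
   at most one j, hence fixed coins succeed on at most 2^q of the inputs.
   Averaging over the coins yields (1 - delta) n / 2 <= 2^q. *)

Require Import Defs.
From HB Require Import structures.
From mathcomp Require Import all_boot all_order all_algebra.
From mathcomp Require Import all_classical all_reals all_analysis.
From mathcomp Require Import measurable_realfun lra.
Import Order.TTheory GRing.Theory Num.Theory.
Local Open Scope ring_scope.

(** Induction on [q]. At a query, split [J] by whether the answer is [None]: on each half all inputs
    get the same answer, hence continue with the same subtree and one query fewer, so each half has
    at most [2 ^ q] elements. *)
Lemma card_injective_estimates (n : nat) (E : eqType)
    (psi : {set assignment n} -> formula n)
    (O : formula n -> option (assignment n)) (I : finType) (phi : I -> formula n)
    (ans : {set assignment n} -> option (assignment n)) :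
  (forall A i, O (FAnd (phi i) (psi A)) = None \/
               O (FAnd (phi i) (psi A)) = ans A) ->
  forall (q : nat) (a : algorithm n E) (J : {set I}),
    {in J, forall i, (num_queries psi O (phi i) a <= q)%N} ->
    {in J &, injective (fun i => estimate psi O (phi i) a)} ->
    (#|J| <= 2 ^ q)%N.
Proof.
move=> O_ans; elim=> [|q IHq] [e|A k] J queryJ injJ /=.
- by apply/card_le1_eqP => i j Ji Jj; apply: injJ.
(* With a zero budget and a query at the root, [J] must be empty. *)
- rewrite leqNgt; apply/negP => /ltnW/card_gt0P[i Ji].
  by have := queryJ i Ji.
- apply: (@leq_trans 1%N); last by rewrite expn_gt0.
  by apply/card_le1_eqP => i j Ji Jj; apply: injJ.
- pose JN := [set i | O (FAnd (phi i) (psi A)) == None]%SET.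
  rewrite -(cardsID JN J) expnS mul2n -addnn leq_add //.
  + apply: (IHq (k None)) => [i|i j]; rewrite !inE.
      by case/andP=> Ji /eqP Oi; have := queryJ i Ji; rewrite /= Oi.
    case/andP=> Ji /eqP Oi /andP[Jj /eqP Oj] ij.
    by apply: injJ => //=; rewrite Oi Oj.
  + have ansJ i : (i \in J :\: JN)%SET -> O (FAnd (phi i) (psi A)) = ans A.
      by rewrite !inE; case: (O_ans A i) => [->|//]; rewrite eqxx.
    apply: (IHq (k (ans A))) => [i Ji|i j Ji Jj ij].
      have : i \in J by move: Ji; rewrite inE => /andP[].
      by move/queryJ; rewrite /= ansJ.
    apply: injJ; rewrite /= ?ansJ //.
      by move: Ji; rewrite inE => /andP[].
    by move: Jj; rewrite inE => /andP[].
Qed.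

Section FirstOracle.
Variable n : nat.

Definition first_oracle (f : formula n) : option (assignment n) :=
  ohead (enum (sol f)).

Definition initial_segment (m : nat) : {set assignment n} :=
  [set s in take m (enum {: assignment n})]%SET.

Lemma first_oracle_sat : sat_oracle first_oracle.
Proof.
move=> f; rewrite /first_oracle; case E : (enum (sol f)) => [|s r] /=.
  by apply/finset.setP => s; rewrite finset.in_set0 -mem_enum E.
by rewrite -mem_enum E mem_head.
Qed.

Lemma card_initial_segment m :
  (m <= 2 ^ n)%N -> #|initial_segment m| = m.
Proof.
move=> le_m; rewrite /initial_segment cardsE.
rewrite (card_uniqP _) ?take_uniq ?enum_uniq// size_takel//.
by rewrite -cardE card_ffun card_bool card_ord.
Qed.

(** The solutions of the conjunction, in enumeration order, form a prefix of [enum A], and a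
    nonempty prefix has the same head as the whole list. *)
Lemma first_oracle_initial_segment (phi f : formula n) (A : {set assignment n})
    (m : nat) :
  sol phi = initial_segment m -> sol f = A ->
  first_oracle (FAnd phi f) = None \/
  first_oracle (FAnd phi f) = ohead (enum A).
Proof.
move=> solphi solf; rewrite /first_oracle.
pose e := enum {: assignment n}.
have enumE (B : {set assignment n}) : enum B = [seq s <- e | s \in B].
  by rewrite /e /enum_mem filter_predT.
have -> : enum (sol (FAnd phi f)) = [seq s <- take m e | s \in A].
  have in_sol s : s \in sol (FAnd phi f) = (s \in take m e) && (s \in A).
    by rewrite -solf inE /= !inE; congr (_ && _);
      move/finset.setP/(_ s): solphi; rewrite !inE.
  (* The enumeration has no duplicates, so nothing from position [m] on lies in the initial
     segment. *)
  have dis : [seq s <- drop m e | s \in sol (FAnd phi f)] = [::].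
    apply/eqP; rewrite -[_ == _]negbK -has_filter; apply/hasPn => s sd.
    rewrite in_sol negb_and; apply/orP; left.
    have : uniq (take m e ++ drop m e) by rewrite cat_take_drop enum_uniq.
    rewrite cat_uniq => /and3P[_ /hasPn/(_ s sd) nst _]; exact: nst.
  rewrite enumE -[in LHS](cat_take_drop m e) filter_cat dis cats0.
  by apply: eq_in_filter => s st; rewrite in_sol st.
rewrite [enum A]enumE -[in X in _ \/ _ = X](cat_take_drop m e) filter_cat.
by case: [seq s <- take m e | s \in A] => [|s r]; [left|right].
Qed.

End FirstOracle.

(** By linearity, the sum is the expected number of events [B i] that occur, and this number is
    almost surely at most [K]. *)
Lemma sum_probability_le (R : realType) (d : measure_display)
    (T : measurableType d) (P : probability T R) (I : finType) (B : I -> set T)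
    (K : nat) :
  (forall i, measurable (B i)) ->
  {ae P, forall w, (#|[set i | `[< B i w >]]%SET| <= K)%N} ->
  (\sum_i P (B i) <= K%:R%:E)%E.
Proof.
move=> mB BK.
have mind i : measurable_fun setT (EFin \o (\1_(B i) : T -> R)).
  by apply/measurable_EFinP; exact: measurable_indic.
have -> : (\sum_i P (B i) = \int[P]_w \sum_i (\1_(B i) w)%:E)%E.
  rewrite ge0_integral_sum//.
  by apply: eq_bigr => i _; rewrite integral_indic// setIT.
have <- : (\int[P]_w (cst K%:R%:E w) = K%:R%:E)%E.
  by rewrite integral_cst//= probability_setT mule1.
apply: ae_ge0_le_integral => //.
- by move=> w _; apply: sume_ge0 => i _; rewrite lee_fin.
- exact: emeasurable_sum.
- by move=> w _; rewrite lee_fin.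
apply: filterS BK => w BwK _ /=.
rewrite sumEFin lee_fin.
suff -> : \sum_i \1_(B i) w = #|[set i | `[< B i w >]]%SET|%:R :> R.
  by rewrite ler_nat.
rewrite -sum1_card natr_sum [RHS]big_mkcond /=; apply: eq_bigr => i _.
by rewrite indicE inE; case: asboolP => Bi; rewrite ?(mem_set Bi) ?memNset.
Qed.

Lemma inputs_le_pow2_queries (R : realType) (eps delta : R) (n : nat)
    (psi : {set assignment n} -> formula n) (d : measure_display)
    (T : measurableType d) (P : probability T R) (alg : T -> algorithm n R)
    (q : nat) :
  0 < eps < 1 -> defines_sets psi ->
  randomized_counter P eps delta psi alg -> makes_at_most P q psi alg ->
  (1 - delta) * (n./2.+1)%:R <= 2 ^+ q.
Proof.
move=> /andP[eps0 eps1] psiP counter queries.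
(* The index stops at [n./2], the last exponent with [4 ^ j <= 2 ^ n]. *)
pose phi (j : 'I_n./2.+1) := psi (initial_segment n (4 ^ j)).
pose est j w := estimate psi (first_oracle n) (phi j) (alg w).
pose B (j : 'I_n./2.+1) : set T :=
  [set w | (4 ^ j)%:R / (1 + eps) <= est j w <= (1 + eps) * (4 ^ j)%:R]%classic.
have card_phi j : #|sol (phi j)| = (4 ^ j)%N.
  rewrite psiP card_initial_segment// -[4%N]/(2 ^ 2)%N -expnM leq_exp2l//.
  by rewrite mul2n -geq_half_double -ltnS.
have mB j : measurable (B j).
  have [mest _] := counter (phi j) _ (first_oracle_sat n).
  have -> : (B j = setT `&` est j @^-1`
      `[(4 ^ j)%:R / (1 + eps), (1 + eps) * (4 ^ j)%:R])%classic.
    by rewrite setTI; apply/seteqP; split=> w; rewrite /B /= in_itv.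
  exact: mest.
have PB j : ((1 - delta)%:E <= P (B j))%E.
  have [_] := counter (phi j) _ (first_oracle_sat n).
  by rewrite /approximates card_phi.
(* Equal estimates would give [4 ^ j <= (1 + eps) ^+ 2 * 4 ^ i < 4 * 4 ^ i <= 4 ^ j]. *)
have disjB w (i j : 'I_n./2.+1) : (i < j)%N -> B i w -> B j w -> est i w <> est j w.
  move=> ltij /andP[_ leB] /andP[geB _] eij.
  have := le_trans geB; rewrite -eij => /(_ _ leB).
  rewrite ler_pdivrMr; last by lra.
  have : (4 * 4 ^ i)%:R <= (4 ^ j)%:R :> R by rewrite ler_nat -expnS leq_exp2l.
  have : (0 : R) < (4 ^ i)%:R by rewrite ltr0n expn_gt0.
  rewrite natrM; set x := (4 ^ i)%:R; set y := (4 ^ j)%:R => x0 xy yx.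
  have lt4 : (1 + eps) * (1 + eps) < 4 by nra.
  have : x * ((1 + eps) * (1 + eps)) < x * 4 by rewrite ltr_pM2l.
  by lra.
have BK : {ae P, forall w, (#|[set j | `[< B j w >]]%SET| <= 2 ^ q)%N}.
  (* The exceptional null set may depend on the input; as there are finitely many inputs, the union
     of these sets is still null. *)
  have all_queries : {ae P, forall w, forall j,
      (num_queries psi (first_oracle n) (phi j) (alg w) <= q)%N}.
    by apply: filter_forall => j; apply: queries; exact: first_oracle_sat.
  apply: filterS all_queries => w qw.
  apply: (@card_injective_estimates n R psi (first_oracle n) _ phi
    (fun A => ohead (enum A)) _ q (alg w)).
  - by move=> A j; apply: first_oracle_initial_segment; apply: psiP.
  - by move=> j _; apply: qw.
  - move=> i j; rewrite !inE => Bi Bj eij.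
    apply/val_inj/eqP; case: ltngtP => // lt; exfalso.
      exact: (disjB w i j lt Bi Bj eij).
    exact: (disjB w j i lt Bj Bi (esym eij)).
have := @sum_probability_le _ _ _ P _ B _ mB BK.
have : (\sum_(j < n./2.+1) (1 - delta)%:E <= \sum_j P (B j))%E.
  by apply: lee_sum => j _; apply: PB.
move=> /le_trans/[apply]; rewrite sumEFin lee_fin natrX.
by rewrite sumr_const card_ord mulr_natr.
Qed.

(** Taking logarithms bounds [q] below by [ln n + ln k]. The division by [ln (ln n)], which tends to
    infinity, leaves room to absorb the constant [ln k]. *)
Lemma ln_div_lnln_le (R : realType) (k : R) : 0 < k ->
  exists N : nat, forall n q : nat, (N <= n)%N ->
    k * n%:R <= 2 ^+ q -> ln (n%:R : R) / ln (ln (n%:R : R)) <= q%:R.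
Proof.
(* The summand [expR 2] forces [ln (ln n) >= 2]; the other one keeps the loss from [ln k] below half
   of [ln n]. *)
move=> k0; pose M := expR 2 + 2 * `|ln k|.
have expR2_gt0 : 0 < expR 2 :> R by exact: expR_gt0.
exists (Num.bound (expR M)) => n q leNn kn.
have expM_n : expR M < n%:R.
  apply: (lt_le_trans (archi_boundP (ltW (expR_gt0 M)))); by rewrite ler_nat.
have n0 : 0 < n%:R :> R by exact: lt_trans (expR_gt0 M) expM_n.
have M_lnn : M < ln n%:R by rewrite -ltr_expR lnK.
have norm0 := normr_ge0 (ln k).
have lnn0 : 0 < ln n%:R :> R by rewrite /M in M_lnn; lra.
have lnln : 2 <= ln (ln n%:R) :> R.
  by rewrite -ler_expR lnK//; rewrite /M in M_lnn; lra.
have lnq : ln k + ln n%:R <= q%:R.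
  rewrite -lnM// -ler_expR lnK ?posrE ?mulr_gt0//.
  apply: (le_trans kn).
  (* Here [2 ^+ q <= expR 1 ^+ q], because [1 + 1 <= expR 1]. *)
  rewrite -[q%:R]mulr1 expRM_natl.
  apply: lerXn2r; rewrite ?nnegrE ?expR_ge0//.
  by have := expR_ge1Dx (1 : R); lra.
rewrite ler_pdivrMr; last by lra.
(* The chain is [ln n <= 2 * (ln n + ln k) <= 2 * q <= q * ln (ln n)]. *)
have := ler_norm (- ln k); rewrite normrN => leN.
have q0 : 0 <= q%:R :> R by [].
rewrite /M in M_lnn; nra.
Qed.

Theorem theorem1 (R : realType) (eps delta : R)
    (heps : 0 < eps < 1) (hdelta : 0 < delta < 1) :
  exists2 c : R, 0 < c &
  exists N : nat, forall n : nat, (N <= n)%N ->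
  forall psi : {set assignment n} -> formula n, defines_sets psi ->
  forall (d : measure_display) (T : measurableType d) (P : probability T R)
    (alg : T -> algorithm n R) (q : nat),
    randomized_counter P eps delta psi alg ->
    makes_at_most P q psi alg ->
    c * (ln (n%:R : R) / ln (ln (n%:R : R))) <= q%:R.
Proof.
exists 1 => //; have [_ delta1] := andP hdelta.
(* The factor 1/2 in [k] pays for replacing [n./2.+1] by [n]. *)
have [|N NP] := @ln_div_lnln_le R ((1 - delta) / 2); first by lra.
exists N => n leNn psi psiP d T P alg q counter queries.
rewrite mul1r; apply: (NP n q leNn).
apply: le_trans
  (inputs_le_pow2_queries _ _ _ _ _ _ _ _ _ _ heps psiP counter queries).
have : n%:R <= 2 * (n./2.+1)%:R :> R.
  by rewrite -natrM ler_nat mul2n ltnW// -ltn_half_double.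
by move: (n%:R) (n./2.+1%:R) => x y; nra.
Qed.
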